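(* Let $\mathbf{x}=(x_i)_{i\in I}\in\mathbf{X}$, let $\mathbf{F}=\{\mathbf{u}\in\mathbf{X}:\mathbf{u}=\mathbf{T}(\mathbf{u}+\mathbf{v})\}$, and set $\mathbf{y}=\lim_{n\to\infty}P_{\mathbf{F}}(n\mathbf{v}+\mathbf{T}^n\mathbf{x})$ (this limit exists). Then $$P_{\mathbf{\Delta}}\mathbf{T}^n\mathbf{x}\to P_{\mathbf{\Delta}}\mathbf{y}\in\operatorname{argmin}\big(\iota_{\mathbf{\Delta}}+\mathbf{g}(\cdot-\mathbf{v})\big),$$ $$\mathbf{T}^{n+1}\mathbf{x}-\mathbf{T}^n\mathbf{x}+P_{\mathbf{\Delta}}\mathbf{T}^n\mathbf{x}=\operatorname{Prox}_{\mathbf{g}}(R_{\mathbf{\Delta}}\mathbf{T}^n\mathbf{x})\to-\mathbf{v}+P_{\mathbf{\Delta}}\mathbf{y},$$ and $$\mathbf{g}\big(\operatorname{Prox}_{\mathbf{g}}(R_{\mathbf{\Delta}}\mathbf{T}^n\mathbf{x})\big)\to\min\big(\iota_{\mathbf{\Delta}}+\mathbf{g}(\cdot-\mathbf{v})\big).$$ Furthermore, $$e(P_{\mathbf{\Delta}}\mathbf{y})\in\operatorname{argmin}\Big(\sum_{i\in I}g_i(\cdot-v_i)\Big).$$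
   Context: $X$ is a finite-dimensional real Hilbert space, $m\in\{2,3,\ldots\}$, $I=\{1,\ldots,m\}$, and for each $i\in I$, $g_i\colon X\to\,]-\infty,+\infty]$ is convex, lower semicontinuous and proper. $\mathbf{X}=\bigoplus_{i\in I}X$ is the product Hilbert space ($m$ copies of $X$ with inner product $\sum_i\langle x_i,y_i\rangle$); $\mathbf{g}\colon\mathbf{X}\to\,]-\infty,+\infty]$, $\mathbf{g}((x_i)_{i\in I})=\sum_{i\in I}g_i(x_i)$, with Fenchel conjugate $\mathbf{g}^*$; $\mathbf{\Delta}=\{(x,x,\ldots,x)\in\mathbf{X}:x\in X\}$; $e\colon\mathbf{X}\to X$, $e((x_i)_{i\in I})=\tfrac1m\sum_{i\in I}x_i$. $P_C$ denotes the projector onto a nonempty closed convex set $C$, $R_{\mathbf{\Delta}}=2P_{\mathbf{\Delta}}-\operatorname{Id}$, $\iota_{\mathbf{\Delta}}$ is the indicator function of $\mathbf\Delta$, $N_{\mathbf{\Delta}}$ is the normal cone operator ($\mathbf{\Delta}^\perp$ on $\mathbf{\Delta}$, $\varnothing$ elsewhere), and $\operatorname{Prox}_h(x)$ is the unique minimizer of $z\mapsto h(z)+\tfrac12\|x-z\|^2$. $\mathbf{T}=\operatorname{Id}-P_{\mathbf{\Delta}}+\operatorname{Prox}_{\mathbf{g}}R_{\mathbf{\Delta}}$; $\mathbf{v}=(v_i)_{i\in I}=P_{\overline{\operatorname{ran}}(\operatorname{Id}-\mathbf{T})}(\mathbf{0})$; $\mathbf{Z}=\{\mathbf{x}\in\mathbf{X}:\mathbf{v}\in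 N_{\mathbf{\Delta}}(\mathbf{x})+\partial\mathbf{g}(\mathbf{x}-\mathbf{v})\}$. Standing assumptions: $\mathbf{0}\in\mathbf{\Delta}^\perp+\operatorname{dom}\mathbf{g}^*$ and $\mathbf{Z}\neq\varnothing$. *)

(* Defs.v *)
From HB Require Import structures.
From mathcomp Require Import all_boot all_order all_algebra.
From mathcomp Require Import sesquilinear ring lra.
From mathcomp Require Import all_classical all_reals all_analysis.
Set Implicit Arguments.
Unset Strict Implicit.
Unset Printing Implicit Defensive.
Import Order.TTheory GRing.Theory Num.Theory.
Import numFieldNormedType.Exports.
Local Open Scope classical_set_scope.
Local Open Scope ring_scope.

(* Finite-dimensional real Hilbert spaces: the topology is the one of the norm
   induced by the inner product; completeness is automatic in finite dimension. *)
HB.mixin Record NormedModule_hasInner (R : realType) V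
    & NormedModule R V := {
  inner_form : {dot V for idfun} ;
  norm_inner_form : forall x : V, `|x| = Num.sqrt (inner_form x x) }.

#[short(type="finHilbertType")]
HB.structure Definition FinHilbert (R : realType) :=
  {V of NormedModule R V & Vector R V & NormedModule_hasInner R V}.

Section InnerTheory.
Context (R : realType) (V : finHilbertType R).
Implicit Types x y z : V.

Definition inner x y : R := inner_form x y.

Lemma norm_inner x : `|x| = Num.sqrt (inner x x).
Proof. exact: norm_inner_form. Qed.

Lemma innerC x y : inner x y = inner y x.
Proof. by rewrite /inner hermC expr0 mul1r. Qed.

Lemma innerDl x y z : inner (x + y) z = inner x z + inner y z.
Proof. exact: linearDl. Qed.

Lemma innerZl (a : R) x y : inner (a *: x) y = a * inner x y.
Proof. exact: linearZl_LR. Qed.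

Lemma innerNl x y : inner (- x) y = - inner x y.
Proof. exact: linearNl. Qed.

Lemma innerBl x y z : inner (x - y) z = inner x z - inner y z.
Proof. exact: linearBl. Qed.

Lemma inner_gt0 x : x != 0 -> 0 < inner x x.
Proof. exact: neq0_dnorm_gt0. Qed.

Lemma inner_ge0 x : 0 <= inner x x.
Proof.
have [->|x0] := eqVneq x 0; last exact/ltW/inner_gt0.
by rewrite /inner linear0l.
Qed.

End InnerTheory.

Section InducedNorm.
Context (R : realType) (V : lmodType R) (d : {dot V for idfun}).

Definition dot_norm (x : V) : R := Num.sqrt (d x x).

Let dC x y : d x y = d y x.
Proof. by rewrite hermC expr0 mul1r. Qed.
Let dDl x y z : d (x + y) z = d x z + d y z.
Proof. by rewrite linearDl. Qed.
Let dZl a x y : d (a *: x) y = a * d x y.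
Proof. by rewrite linearZl_LR. Qed.
Let dDr x y z : d x (y + z) = d x y + d x z.
Proof. by rewrite dC dDl !(dC x). Qed.
Let dZr a x y : d x (a *: y) = a * d x y.
Proof. by rewrite dC dZl dC. Qed.
Let d_ge0 x : 0 <= d x x.
Proof.
have [->|x0] := eqVneq x 0; first by rewrite linear0l.
exact/ltW/neq0_dnorm_gt0.
Qed.

Lemma dot_CauchySchwarz x y : d x y ^+ 2 <= d x x * d y y.
Proof.
have [->|y0] := eqVneq y 0.
  by rewrite !linear0r expr2 !mulr0.
have yy : 0 < d y y by exact: neq0_dnorm_gt0.
have := d_ge0 (d y y *: x + (- d x y) *: y).
rewrite !(dDl, dDr, dZl, dZr) (dC y x) => h.
rewrite -subr_ge0 -(pmulr_rge0 _ yy).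
apply: le_trans h _; rewrite le_eqVlt; apply/orP; left; apply/eqP; ring.
Qed.

Lemma dot_norm_triangle x y : dot_norm (x + y) <= dot_norm x + dot_norm y.
Proof.
have s0 z : 0 <= dot_norm z by exact: sqrtr_ge0.
rewrite -(@ler_pXn2r _ 2) ?nnegrE ?addr_ge0// sqrrD !sqr_sqrtr//.
have le_xy : d x y <= dot_norm x * dot_norm y.
  rewrite (le_trans (ler_norm _))// -sqrtr_sqr /dot_norm -sqrtrM//.
  exact/ler_wsqrtr/dot_CauchySchwarz.
rewrite dDl !dDr (dC y x) mulr2n; lra.
Qed.

Lemma dot_normZ a x : dot_norm (a *: x) = `|a| * dot_norm x.
Proof.
by rewrite /dot_norm dZl dZr mulrA -expr2 sqrtrM ?sqr_ge0// sqrtr_sqr.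
Qed.

Lemma dot_norm0_eq0 x : dot_norm x = 0 -> x = 0.
Proof.
move=> x0; apply/eqP/negPn/negP => xn0.
have : 0 < d x x by exact: neq0_dnorm_gt0.
by rewrite -sqrtr_gt0 -/(dot_norm x) x0 ltxx.
Qed.

End InducedNorm.

(* The Hilbert direct sum of copies of X indexed by a finite type; its norm is
   the Euclidean one, not the sup norm. *)
Section HilbertSum.
Context (R : realType) (X : finHilbertType R) (I : finType).
Implicit Types x y : {ffun I -> X}.

Definition sum_inner x y : R := \sum_i inner (x i) (y i).

Let sum_inner_bilinear :
  bilinear_for (GRing.Scale.Law.clone _ _ *%R _)
    (GRing.Scale.Law.clone _ _ (idfun \; *%R) _) sum_inner.
Proof.
split=> [y|x] a u w; rewrite /sum_inner /= mulr_sumr -big_split;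
  apply: eq_bigr => i _; rewrite !ffunE.
  by rewrite innerDl innerZl.
by rewrite innerC innerDl innerZl !(innerC (x i)).
Qed.
HB.instance Definition _ := bilinear_isBilinear.Build R
  {ffun I -> X} {ffun I -> X} R _ _ sum_inner sum_inner_bilinear.

Let sum_inner_sym x y : sum_inner x y = (-1) ^+ false * idfun (sum_inner y x).
Proof.
rewrite expr0 mul1r; apply: eq_bigr => i _.
exact: innerC.
Qed.
HB.instance Definition _ := isHermitianSesquilinear.Build R {ffun I -> X}
  false idfun sum_inner sum_inner_sym.

Let sum_inner_gt0 x : x != 0 -> 0 < sum_inner x x.
Proof.
apply: contra_neqT; rewrite -leNgt => le0.
have /eqP : sum_inner x x == 0 by rewrite eq_le le0 sumr_ge0// => i _; exact: inner_ge0.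
move=> /psumr_eq0P x0; apply/ffunP => i; rewrite ffunE.
apply/eqP/negPn/negP => xi0.
have := inner_gt0 xi0.
by rewrite x0 ?ltxx// => j _; exact: inner_ge0.
Qed.
HB.instance Definition _ := isDotProduct.Build R {ffun I -> X}
  sum_inner sum_inner_gt0.

HB.instance Definition _ := Lmodule_isNormed.Build R {ffun I -> X}
  (dot_norm_triangle sum_inner) (dot_normZ sum_inner)
  (@dot_norm0_eq0 _ _ sum_inner).

HB.instance Definition _ := NormedModule_hasInner.Build R {ffun I -> X}
  (fun=> erefl).

End HilbertSum.

Section ConvexAnalysis.
Context {R : realType} {H : finHilbertType R}.
Implicit Types (f : H -> \bar R) (A B C : set H) (x y z u : H).
Local Open Scope ereal_scope.

Definition effective_dom f : set H := [set x | f x < +oo].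

Definition eproper f := (forall x, -oo < f x) /\ effective_dom f !=set0.

(* Since 0 * +oo = 0, the endpoints of [0, 1] are harmless; no +oo - oo can
   occur because the predicate is only used on functions with values > -oo. *)
Definition econvex f := forall x y (t : R), (0 <= t <= 1)%R ->
  f (t *: x + (1 - t) *: y)%R <= t%:E * f x + (1 - t)%:E * f y.

Definition convex_lsc_proper f :=
  [/\ econvex f, lower_semicontinuous f & eproper f].

Definition argmin f : set H := [set x | forall y, f x <= f y].

(* The value is attained, hence a minimum, as soon as argmin f is nonempty. *)
Definition minval f : \bar R := ereal_inf (range f).

Definition indicator_fun C x : \bar R := if x \in C then 0 else +oo.

Definition fenchel_conjugate f u : \bar R :=
  ereal_sup (range (fun x => (inner x u)%:E - f x)).

Definition subdifferential f x : set H :=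
  [set u | forall y, (inner (y - x)%R u)%:E + f x <= f y].

Definition orthogonal_compl C : set H :=
  [set u | forall x, C x -> inner x u = 0%R].

Definition normal_cone C x : set H :=
  [set u | C x /\ forall c, C c -> (inner (c - x)%R u <= 0)%R].

Definition minkowski_sum A B : set H := [set (a + b)%R | a in A & b in B].

(* For a nonempty closed convex C the nearest point is unique. *)
Definition projector C x : H :=
  xget 0%R [set p | C p /\ forall q, C q -> (`|x - p| <= `|x - q|)%R].

Definition reflector C x : H := (2 *: projector C x - x)%R.

(* For f convex, lower semicontinuous and proper the minimizer is unique. *)
Definition prox f x : H :=
  xget 0%R (argmin (fun z => f z + (2^-1 * `|x - z| ^+ 2)%:E)).

Definition DR_operator C f x : H := (x - projector C x + prox f (reflector C x))%R.

Definition min_displacement (T : H -> H) : H :=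
  projector (closure (range (fun x => x - T x)%R)) 0%R.

End ConvexAnalysis.

Section ProductSpace.
Context {R : realType} {X : finHilbertType R} {m : nat}.
Implicit Types x : {ffun 'I_m -> X}.

Definition diag_subspace : set {ffun 'I_m -> X} := range (fun z : X => [ffun=> z]).

Definition separable_sum (g : 'I_m -> X -> \bar R) x : \bar R :=
  (\sum_(i < m) g i (x i))%E.

Definition average x : X := m%:R^-1 *: \sum_(i < m) x i.

Lemma normal_cone_diag x :
  normal_cone diag_subspace x =
  [set u | diag_subspace x /\ orthogonal_compl diag_subspace u].
Proof.
apply/seteqP; split=> u [[a _ ax] xu]; (split; first by exists a) => c.
  move=> [z _ zc].
  have P w : inner ([ffun=> w] : {ffun 'I_m -> X}) u <= 0.
    have := xu [ffun=> a + w]; rewrite -ax.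
    have -> : [ffun=> a + w] - [ffun=> a] = [ffun=> w] :> {ffun 'I_m -> X}.
      by apply/ffunP => i; rewrite !ffunE addrC addKr.
    by apply; exists (a + w).
  apply/eqP; rewrite eq_le -zc P/= -oppr_le0.
  have := P (- z).
  have -> : [ffun=> - z] = - [ffun=> z] :> {ffun 'I_m -> X}.
    by apply/ffunP => i; rewrite !ffunE.
  by rewrite innerNl.
move=> Dc; rewrite innerBl (xu _ Dc) xu ?subrr//.
by exists a.
Qed.

End ProductSpace.

(* Main.v *)
Require Import Defs.
From HB Require Import structures.
From mathcomp Require Import all_boot all_order all_algebra.
From mathcomp Require Import sesquilinear ring lra.
From mathcomp Require Import all_classical all_reals all_analysis.
Set Implicit Arguments.
Unset Strict Implicit.
Unset Printing Implicit Defensive.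
Import Order.TTheory GRing.Theory Num.Theory.
Import numFieldNormedType.Exports.
Local Open Scope classical_set_scope.
Local Open Scope ring_scope.

(** The argument takes place in the product space H, with D the diagonal, P the
    projector onto D and G the separable sum.

    Write a point as [x = z + k] with [z] in [D] and [k] orthogonal to [D]. Then
    [x - T x = v] means that [v - k] is a subgradient of [G] at [z - v]
    ([DR_displacementP]). A point of [Z] thus yields an attained displacement
    equal to [v]. Since [T] is firmly nonexpansive and [v] is a displacement of
    minimal norm, [T] shifts each point of displacement [v] by [- v] and keeps
    its displacement ([displacement_orbit]). Two consequences follow by letting
    the number of shifts grow in the subgradient inequality: [v] is orthogonal
    to [D], because [G] has an affine minorant whose slope is orthogonal to [D]
    ([displacement_orthogonal]), and [v] is normal to the domain of [G]
    ([domain_halfspace]).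

    The sequence [s n = n v + T^n x] is Fejer monotone with respect to the set
    [F], which is closed and convex. So the projections of [s n] onto [F]
    converge ([Fejer_projection_cvg]), and the displacements along the orbit
    tend to [v] ([displacement_cvg]). The subgradient of [G] at the proximal
    point [p n] is [(n + 1) v] plus a bounded vector; its unbounded part has a
    favourable sign by normality of [v], and this forces [G (p n)] to tend to
    the minimum of [G (. - v)] on [D] ([objective_cvg]).

    By lower semicontinuity every cluster point of the shadows [P (T^n x)] is a
    minimizer. The set [F] is, up to the shift by [v], the sum of the set of
    minimizers and of a set of vectors orthogonal to [D]
    ([subdifferential_exchange]). Opial's argument then gives convergence of the
    shadows ([shadow_cvg]), and the same product structure identifies their
    limit with [P y] ([DR_shadow_limit]).

    The last assertion is the minimality of [P y] read on constant families. *)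

(** * Inner product calculus *)

Section InnerAlgebra.
Context {R : realType} {H : finHilbertType R}.
Implicit Types x y z u : H.

Lemma innerDr x y z : inner x (y + z) = inner x y + inner x z.
Proof. by rewrite innerC innerDl !(innerC x). Qed.

Lemma innerZr (a : R) x y : inner x (a *: y) = a * inner x y.
Proof. by rewrite innerC innerZl innerC. Qed.

Lemma innerNr x y : inner x (- y) = - inner x y.
Proof. by rewrite innerC innerNl innerC. Qed.

Lemma inner0l y : inner 0 y = 0.
Proof. by have := innerZl 0 y y; rewrite scale0r mul0r. Qed.

Lemma inner0r y : inner y 0 = 0.
Proof. by rewrite innerC inner0l. Qed.

Definition innerE :=
  (@innerDl R H, @innerNl R H, @innerZl R H, innerDr, innerNr, innerZr, inner0l, inner0r).

Lemma normr2 x : `|x| ^+ 2 = inner x x.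
Proof. by rewrite norm_inner sqr_sqrtr// inner_ge0. Qed.

Lemma inner_eq0 x : inner x x = 0 -> x = 0.
Proof. by rewrite -normr2 => /eqP; rewrite sqrf_eq0 normr_eq0 => /eqP. Qed.

Lemma inner_ext x y : (forall u, inner x u = inner y u) -> x = y.
Proof.
move=> xy; apply/subr0_eq/inner_eq0.
by rewrite innerBl xy subrr.
Qed.

Lemma ler_norm_inner x y : (`|x| <= `|y|) = (inner x x <= inner y y).
Proof. by rewrite -!normr2 ler_pXn2r// nnegrE. Qed.

Lemma CauchySchwarz x y : `|inner x y| <= `|x| * `|y|.
Proof.
rewrite !norm_inner -sqrtrM ?inner_ge0// -sqrtr_sqr.
exact/ler_wsqrtr/dot_CauchySchwarz.
Qed.

End InnerAlgebra.

(** Vector identities are checked by pairing both sides with an arbitrary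
    vector, which turns them into identities of a commutative ring. *)
Ltac vect := apply: inner_ext => ?; rewrite !innerE; (ring || lra).

(** * Compactness and cluster points in finite dimension *)

Section Compactness.
Context {R : realType} {H : finHilbertType R}.

Lemma linear_rV_continuous n (f : {linear 'rV[R]_n -> H}) : continuous f.
Proof.
have -> : (f : 'rV[R]_n -> H) =
    (fun a : 'rV[R]_n => \sum_(i < n) a ord0 i *: f (delta_mx ord0 i)).
  apply/funext => a; rewrite {1}[a]row_sum_delta linear_sum.
  by apply: eq_bigr => i _; rewrite linearZ.
apply: continuous_big; first exact: add_continuous.
move=> i _ a; apply: (@cvgZr_tmp _ _ _ (nbhs a)); exact: (@coord_continuous R 1 n ord0 i a).
Qed.

(** The coordinates [inner x b_j] of [x] against a basis are bounded by
    Cauchy-Schwarz and determine [x] linearly, so a bounded set is contained in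
    the continuous image of a compact set of row vectors. *)
Lemma Hilbert_bounded_closed_compact (A : set H) (B : R) :
  (forall x, A x -> `|x| <= B) -> closed A -> compact A.
Proof.
move=> AB clA.
pose b := vbasis {:H}.
pose n := \dim {:H}.
pose phi (x : H) : 'rV[R]_n := \row_j inner x b`_j.
have phil : linear phi.
  by move=> a x y; apply/rowP => j; rewrite !mxE !innerE.
pose phiL : {linear H -> 'rV[R]_n} := HB.pack phi (GRing.isLinear.Build _ _ _ _ phi phil).
have ker0 : lker (linfun phiL) == 0%VS.
  apply/lker0P => x y; rewrite !lfunE /= => xy.
  apply/subr0_eq/inner_eq0.
  set d := x - y.
  have dj (j : 'I_n) : inner d b`_j = 0.
    by move/rowP/(_ j) : xy; rewrite !mxE innerBl => ->; rewrite subrr.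
  rewrite [X in inner _ X](coord_vbasis (memvf d)).
  elim/big_ind : _ => [|u w u0 w0|i _]; first by rewrite inner0r.
  - by rewrite innerDr u0 w0 addr0.
  - by rewrite innerZr dj mulr0.
pose L : {linear 'rV[R]_n -> H} := ((linfun phiL)^-1)%VF.
have LK x : L (phi x) = x.
  by have := lker0_lfunK ker0 x; rewrite lfunE.
pose C := \sum_(j < n) `|b`_j|.
pose K := [set a : 'rV[R]_n | `|a| <= `|B| * C].
have C0 : 0 <= C by exact: sumr_ge0.
have cK : compact K.
  apply: bounded_closed_compact.
    exists (`|B| * C); split; first exact: num_real.
    by move=> M ltM a; rewrite /K /= => aB; exact: le_trans aB (ltW ltM).
  apply: (@closed_comp _ _ (fun a : 'rV[R]_n => `|a|) [set x | x <= `|B| * C]).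
    by move=> x _; exact: norm_continuous.
  exact: closed_le.
have cLK : compact (L @` K).
  apply: continuous_compact => //.
  by apply: continuous_subspaceT; exact: linear_rV_continuous.
apply: (subclosed_compact clA cLK) => x Ax.
exists (phi x) => //; rewrite /K /=.
rewrite [leLHS]mx_normrE; apply/bigmax_leP; split=> [|[i j] _ /=].
  exact: mulr_ge0.
rewrite mxE (le_trans (CauchySchwarz _ _))// ler_pM//.
  exact: le_trans (AB _ Ax) (ler_norm _).
by rewrite /C (bigD1 j)//= lerDl sumr_ge0.
Qed.

End Compactness.

Section ClusterPoints.
Context {R : realType} {H : finHilbertType R}.
Implicit Types (s : nat -> H) (c : H).

(** The sequential form of [cluster (s @ \oo) c]. *)
Definition cluster_pt s c :=
  forall e : R, 0 < e -> forall N, exists2 n, (N <= n)%N & `|s n - c| < e.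

Lemma bounded_cluster_pt s B : (forall n, `|s n| <= B) -> exists c, cluster_pt s c.
Proof.
move=> sB.
have cK : compact [set x : H | `|x| <= B].
  apply: (@Hilbert_bounded_closed_compact _ _ _ B) => //.
  apply: (@closed_comp _ _ (fun a : H => `|a|) [set x | x <= B]).
    by move=> x _; exact: norm_continuous.
  exact: closed_le.
have [|c [_ cc]] := cK (s @ \oo) _.
  by exists 0%N => // n _; exact: sB.
exists c => e e0 N.
have [|| _ [[n Nn <-] /= sc]] := cc (s @` [set n | (N <= n)%N]) (ball c e).
- by exists N => // n Nn; exists n.
- exact: nbhsx_ballx.
by exists n => //; move: sc; rewrite -ball_normE /= distrC.
Qed.

Lemma cluster_pt_subseq s (f : nat -> nat) c :
  (forall n, n <= f n)%N -> cluster_pt (s \o f) c -> cluster_pt s c.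
Proof.
move=> nf sc e e0 N; have [n Nn sn] := sc e e0 N.
by exists (f n) => //; exact: leq_trans Nn (nf n).
Qed.

(** Otherwise a subsequence stays at positive distance from [c]; it is bounded,
    so it has a cluster point, which differs from [c]. *)
Lemma bounded_unique_cluster_cvg s B c : (forall n, `|s n| <= B) ->
  (forall c', cluster_pt s c' -> c' = c) -> s @ \oo --> c.
Proof.
move=> sB uc; apply/cvgrPdist_lt => e e0; apply: contrapT => far.
have /choice[f fP] : forall N, exists n, (N <= n)%N /\ e <= `|c - s n|.
  move=> N; apply: contrapT => nN; apply: far; exists N => // n /= Nn.
  by rewrite ltNge; apply/negP => h; apply: nN; exists n.
have [c' cc'] := @bounded_cluster_pt (s \o f) B (fun n => sB _).
have c'E : c' = c.
  by apply: uc; apply: cluster_pt_subseq cc' => n; case: (fP n).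
have [n _ /=] := cc' e e0 0%N.
by rewrite c'E distrC ltNge; case: (fP n) => _ ->.
Qed.

Lemma cluster_pt_closed s c (A : set H) : closed A ->
  (\forall n \near \oo, A (s n)) -> cluster_pt s c -> A c.
Proof.
move=> clA [N _ sA] sc; apply: clA => V /nbhs_ballP[e e0 eV].
have [n Nn sn] := sc e e0 N.
exists (s n); split; first exact: sA.
by apply: eV; rewrite -ball_normE /= distrC.
Qed.

Lemma cluster_pt_inner_lim s c u (l : R) : cluster_pt s c ->
  inner (s n) u @[n --> \oo] --> l -> inner c u = l.
Proof.
move=> sc /cvgrPdist_lt sl; apply/eqP; rewrite -subr_eq0 -normr_le0.
apply/ler_addgt0Pl => e e0; rewrite addr0.
have K0 : 0 < `|u| + 1 by rewrite ltr_wpDl.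
have [N _ hN] := sl (e / 2) (divr_gt0 e0 (ltr0Sn R 1)).
have [n Nn sn] := sc (e / 2 / (`|u| + 1)) (divr_gt0 (divr_gt0 e0 (ltr0Sn R 1)) K0) N.
have := hN n Nn; set a := inner (s n) u => aE.
have bE : `|inner c u - a| <= e / 2.
  rewrite /a -innerBl (le_trans (CauchySchwarz _ _))// distrC.
  rewrite -(@divfK _ (`|u| + 1) _ (e / 2)) ?gt_eqF//.
  by apply: ler_pM => //; [exact: ltW | rewrite lerDl].
rewrite (le_trans (ler_distD a _ _))// (splitr e) lerD//.
by rewrite distrC ltW.
Qed.

(** Opial's argument: for cluster points [c] and [c'], the limit of
    [inner (s n) (c - c')] is both [inner c (c - c')] and [inner c' (c - c')],
    whence [c = c']. *)
Lemma opial_cvg s B : (forall n, `|s n| <= B) ->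
  (forall c c', cluster_pt s c -> cluster_pt s c' ->
     cvg (inner (s n) (c - c') @[n --> \oo])) ->
  exists2 c, cluster_pt s c & s @ \oo --> c.
Proof.
move=> sB sc.
have [c cc] := bounded_cluster_pt sB.
exists c => //; apply: bounded_unique_cluster_cvg sB _ => c' cc'.
have sl := sc _ _ cc' cc.
apply/subr0_eq/inner_eq0.
rewrite {1}innerBl (cluster_pt_inner_lim cc' sl) (cluster_pt_inner_lim cc sl).
exact: subrr.
Qed.

End ClusterPoints.

(** * Existence of minimizers and of nearest points *)

Section Minimizers.
Context {R : realType} {H : finHilbertType R}.

(** The values of [f] are only compared, never added, so that the lemma serves
    both distances (real valued) and functions into the extended reals. *)
Lemma Weierstrass_closed {d} {T : orderType d} (C : set H) (f : H -> T) (x0 : H) (B : R) :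
  C x0 -> (forall y, C y -> closed (C `&` [set x | f x <= f y]%O)) ->
  (forall x, C x -> (f x <= f x0)%O -> `|x| <= B) ->
  exists2 c, C c & forall y, C y -> (f c <= f y)%O.
Proof.
move=> Cx0 clf fB.
pose S y := C `&` [set x | f x <= f y]%O.
pose I := S x0.
(* The sublevel sets below level [f x0] are nested; a cluster point of the
   filter that they generate lies in all of them. *)
have cK : compact I.
  apply: (@Hilbert_bounded_closed_compact _ _ _ B); last exact: clf.
  by move=> x [Cx fx]; exact: fB.
have Ix0 : I x0 by split => //=.
have FF : Filter (filter_from I S).
  apply: filter_from_filter; first by exists x0.
  move=> i j [Ci fi] [Cj fj].
  case: (leP (f i) (f j)) => ij.
    exists i => // x [Cx xi]; split; split => //=.
    exact: le_trans xi ij.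
  exists j => // x [Cx xj]; split; split => //=.
  exact: le_trans xj (ltW ij).
have PF : ProperFilter (filter_from I S).
  by apply: filter_from_proper => i [Ci _]; exists i; split => //=.
have [|c [[Cc fc] cc]] := cK _ PF; first by exists x0.
exists c => // y Cy.
case: (leP (f y) (f x0)) => [yx0|/ltW]; last exact: le_trans.
have Iy : I y by [].
have : closure (S y) c by move: cc; rewrite clusterE; apply; exists y.
by move=> /(clf _ Cy)[].
Qed.

Definition nearest (C : set H) x : set H :=
  [set p | C p /\ forall q, C q -> `|x - p| <= `|x - q|].

Lemma projectorP (C : set H) x : closed C -> C !=set0 ->
  nearest C x (projector C x).
Proof.
move=> clC [x0 Cx0]; rewrite /projector; apply: xgetPex.
have [|||c Cc cmin] := @Weierstrass_closed _ R C (fun z => `|x - z|) x0 (`|x| + `|x - x0|).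
- by [].
- move=> y Cy; apply: closedI => //.
  apply: (@closed_comp _ _ (fun a : H => `|x - a|) [set z | z <= `|x - y|]).
    move=> z _; apply: cvg_norm; apply: cvgB; [exact: cvg_cst|exact: cvg_id].
  exact: closed_le.
- move=> z Cz h; rewrite -[z in leLHS](subKr x) (le_trans (ler_normB _ _))//.
  by rewrite lerD2l.
by exists c.
Qed.

End Minimizers.

(** * Fejer monotone sequences *)

Section Fejer.
Context {R : realType} {H : finHilbertType R}.

Lemma nonincreasing_diff_cvg0 (d : nat -> R) :
  (forall n, 0 <= d n) -> (forall n, d n.+1 <= d n) ->
  d n - d n.+1 @[n --> \oo] --> (0 : R).
Proof.
move=> d0 dS.
have dcvg : cvgn d.
  apply: nonincreasing_is_cvgn; first exact/nonincreasing_seqP.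
  by exists 0 => _ [n _ <-].
rewrite -(subrr (limn d)); apply: cvgB => //.
by rewrite cvg_shiftS.
Qed.

Lemma inner_cvg0 (f g : nat -> H) B : (forall n, `|f n| <= B) -> g @ \oo --> (0 : H) ->
  inner (f n) (g n) @[n --> \oo] --> (0 : R).
Proof.
move=> fB g0; apply/norm_cvg0P.
apply: (@squeeze_cvgr _ _ _ _ (fun=> 0) (fun n => B * `|g n|)).
- apply: nearW => n; rewrite normr_ge0/=.
  by rewrite (le_trans (CauchySchwarz _ _))// ler_wpM2r.
- exact: cvg_cst.
- rewrite -[X in _ --> X](mulr0 B); apply: cvgMl_tmp.
  by rewrite -(@normr0 _ H); exact: cvg_norm.
Qed.

Definition Fejer_monotone (F : set H) (s : nat -> H) :=
  forall u, F u -> forall n, `|s n.+1 - u| <= `|s n - u|.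

Lemma Fejer_le F s u : Fejer_monotone F s -> F u ->
  forall n m, (n <= m)%N -> `|s m - u| <= `|s n - u|.
Proof.
move=> fs Fu n m /subnK <-; elim: (m - n)%N => // k; exact: le_trans (fs _ Fu _).
Qed.

Lemma Fejer_dist_cvg F s u : Fejer_monotone F s -> F u ->
  cvgn (fun n => inner (s n - u) (s n - u)).
Proof.
move=> fs Fu; apply: nonincreasing_is_cvgn.
  apply/nonincreasing_seqP => n; rewrite -ler_norm_inner; exact: fs.
by exists 0 => _ [n _ <-]; exact: inner_ge0.
Qed.

Lemma Fejer_bounded F s u : Fejer_monotone F s -> F u ->
  forall n, `|s n| <= `|s 0%N - u| + `|u|.
Proof.
move=> fs Fu n; rewrite -[s n in leLHS](subrK u) (le_trans (ler_normD _ _))//.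
by rewrite lerD2r (Fejer_le fs Fu).
Qed.

Definition midpoint_closed (F : set H) :=
  forall a b, F a -> F b -> F (2^-1 *: (a + b)).

(** The parallelogram law at the midpoint of [y n] and [y m] bounds
    [|y n - y m|^2] by twice the decrease of the squared distance to [F] between
    [n] and [m]. That distance is nonincreasing, so [y] is a Cauchy sequence. *)
Lemma Fejer_projection_cvg F s : closed F -> F !=set0 -> midpoint_closed F ->
  Fejer_monotone F s ->
  exists2 y, F y & projector F (s n) @[n --> \oo] --> y.
Proof.
move=> clF Fn0 midF fs; pose y n := projector F (s n).
have yP n : nearest F (s n) (y n) by exact: projectorP.
have Fy n : F (y n) by case: (yP n).
have ymin n q : F q -> `|s n - y n| <= `|s n - q| by case: (yP n) => _; exact.
pose d n := inner (s n - y n) (s n - y n).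
have key n m : (n <= m)%N ->
    inner (y n - y m) (y n - y m) <= 2 * d n - 2 * d m.
  move=> nm.
  have := Fejer_le fs (Fy n) nm; rewrite ler_norm_inner.
  have := ymin m _ (midF _ _ (Fy n) (Fy m)); rewrite ler_norm_inner.
  rewrite /d !innerE !(innerC (y m) (s m)) !(innerC (y n) (s m)) (innerC (y m) (y n)).
  rewrite (innerC (y n) (s n)).
  lra.
have d0 n : 0 <= d n by exact: inner_ge0.
have dcvg : cvgn d.
  apply: nonincreasing_is_cvgn; last by exists 0 => _ [n _ <-].
  move=> n m nm; have := key _ _ nm; have := inner_ge0 (y n - y m).
  by set a := inner _ _ => a0 h; lra.
have [u Fu] := Fn0.
have yB n : `|y n| <= 2 * (`|s 0%N - u| + `|u|) + `|u|.
  have h1 := ymin n _ Fu; have h2 := Fejer_le fs Fu (leq0n n).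
  have h3 := Fejer_bounded fs Fu n.
  rewrite -[y n in leLHS](subKr (s n)) (le_trans (ler_normB _ _))//.
  have := normr_ge0 u; lra.
have [c cc] := bounded_cluster_pt yB.
exists c.
  by apply: cluster_pt_closed cc => //; exists 0%N.
apply/cvgrPdist_lt => e e0.
have /cvgrPdist_lt/(_ ((e / 2) ^+ 2 / 4)) := dcvg.
have e4 : 0 < (e / 2) ^+ 2 / 4 by rewrite divr_gt0// exprn_gt0// divr_gt0.
move=> /(_ e4)[N _ hN].
have [n0 Nn0 cn0] := cc (e / 2) (divr_gt0 e0 (ltr0Sn R 1)) N.
exists n0 => // n /= n0n.
have yy : `|y n0 - y n| < e / 2.
  rewrite -(@ltr_pXn2r _ 2)// ?nnegrE ?normr_ge0// ?ltW ?divr_gt0//.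
  rewrite normr2 (le_lt_trans (key _ _ n0n))//.
  have := hN _ Nn0; have := hN n (leq_trans Nn0 n0n).
  rewrite !ltr_norml => /andP[h1 h2] /andP[h3 h4]; lra.
rewrite (le_lt_trans (ler_distD (y n0) _ _))// (splitr e) ltrD//.
by rewrite distrC.
Qed.

End Fejer.

(** * Closed convex functions and the proximity operator *)

Section LowerSemicontinuity.
Context {R : realType}.
Local Open Scope ereal_scope.

Lemma lt_adde_split (a : R) (p q : \bar R) : -oo < p -> -oo < q -> a%:E < p + q ->
  exists b c : R, [/\ b%:E < p, c%:E < q & (a < b + c)%R].
Proof.
case: p => [r| |]// _; case: q => [s| |]// _; rewrite ?lte_fin ?ltry => ars.
- exists (r - (r + s - a) / 3)%R, (s - (r + s - a) / 3)%R.
  by rewrite !lte_fin; split; lra.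
- exists (r - 1)%R, (a - r + 2)%R; rewrite lte_fin ltry; split => //; lra.
- exists (a - s + 2)%R, (s - 1)%R; rewrite lte_fin ltry; split => //; lra.
- exists a, 1%R; rewrite !ltry; split => //; lra.
Qed.

Lemma lower_semicontinuousD {X : topologicalType} (f g : X -> \bar R) :
  (forall x, -oo < f x) -> (forall x, -oo < g x) ->
  lower_semicontinuous f -> lower_semicontinuous g ->
  lower_semicontinuous (fun x => f x + g x).
Proof.
move=> f0 g0 lf lg x a /(lt_adde_split (f0 x) (g0 x))[b [c [bf cg abc]]].
have [V xV Vf] := lf _ _ bf; have [W xW Wg] := lg _ _ cg.
exists (V `&` W); first exact: filterI.
move=> y [Vy Wy]; apply: (@lt_trans _ _ (b%:E + c%:E)); first by rewrite lte_fin.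
by apply: lteD; [exact: Vf|exact: Wg].
Qed.

Lemma lower_semicontinuous_comp {X Y : topologicalType} (h : X -> Y) (f : Y -> \bar R) :
  continuous h -> lower_semicontinuous f -> lower_semicontinuous (f \o h).
Proof.
move=> ch lf x a /lf[V hV Vf]; exists (h @^-1` V); first exact: ch.
by move=> y; exact: Vf.
Qed.

Lemma lower_semicontinuous_EFin {X : topologicalType} (f : X -> R) :
  continuous f -> lower_semicontinuous (fun x => (f x)%:E).
Proof.
move=> cf; apply/lower_semicontinuousP => a.
apply: (@open_comp _ _ f [set r | (a < r)%R]); first by move=> x _; exact: cf.
exact: open_gt.
Qed.

Lemma lower_semicontinuous_sublevel {X : topologicalType} (f : X -> \bar R) (M : \bar R) :
  (forall x, -oo < f x) -> lower_semicontinuous f -> closed [set x | f x <= M].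
Proof.
move=> f0 /lower_semicontinuousP lf.
case: M => [r| |].
- rewrite -openC (_ : ~` _ = [set x | r%:E < f x]); first exact: lf.
  by apply/seteqP; split => x /=; rewrite ltNge => /negP.
- rewrite (_ : [set x | _] = setT); first exact: closedT.
  by apply/seteqP; split => // x _ /=; rewrite leey.
- rewrite (_ : [set x | _] = set0); first exact: closed0.
  by apply/seteqP; split => // x /=; rewrite leNgt f0.
Qed.

End LowerSemicontinuity.

Section ConvexLsc.
Context {R : realType}.
Local Open Scope ereal_scope.

(** Unlike [convex_lsc_proper], this class is stable under sums: the effective
    domains of two proper functions may be disjoint. *)
Record closed_convex {H : finHilbertType R} (f : H -> \bar R) : Prop := ClosedConvex {
  cc_ninfty : forall x, -oo < f x ;
  cc_convex : econvex f ;
  cc_lsc : lower_semicontinuous f }.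

Lemma closed_convexD {H : finHilbertType R} (f g : H -> \bar R) :
  closed_convex f -> closed_convex g -> closed_convex (fun x => f x + g x).
Proof.
move=> [f0 cf lf] [g0 cg lg]; split.
- by move=> x; move: (f0 x) (g0 x); case: (f x) => [?||]//; case: (g x) => // *;
  rewrite -?EFinD ltNyr.
- move=> x y t t01; apply: (le_trans (leeD (cf x y t t01) (cg x y t t01))).
  have def z : f z +? g z by apply: ltninfty_adde_def; rewrite inE.
  by rewrite !muleDr// addeACA.
- exact: lower_semicontinuousD.
Qed.

Lemma closed_convex_sum {H : finHilbertType R} (I : Type) (r : seq I)
    (f : I -> H -> \bar R) :
  (forall i, closed_convex (f i)) -> closed_convex (fun x => \sum_(i <- r) f i x).
Proof.
move=> cf; elim: r => [|i r IH].
  rewrite (_ : (fun _ => _) = fun=> 0); last by apply/funext => x; rewrite big_nil.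
  split=> //.
  - by move=> x y t _; rewrite !mule0 adde0.
  - by apply: lower_semicontinuous_EFin => x; exact: cvg_cst.
rewrite (_ : (fun _ => _) = fun x => f i x + \sum_(j <- r) f j x).
  exact: closed_convexD.
by apply/funext => x; rewrite big_cons.
Qed.

Lemma normr_coord_le {X : finHilbertType R} {I : finType} (x : {ffun I -> X}) (i : I) :
  (`|x i| <= `|x|)%R.
Proof.
rewrite !norm_inner ler_wsqrtr//.
rewrite [leRHS](_ : _ = \sum_j inner (x j) (x j))%R// (bigD1 i)//= lerDl.
by apply: sumr_ge0 => j _; exact: inner_ge0.
Qed.

Lemma closed_convex_coord {X : finHilbertType R} {I : finType} (i : I) (f : X -> \bar R) :
  closed_convex f -> closed_convex (fun x : {ffun I -> X} => f (x i)).
Proof.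
move=> [f0 cf lf]; split=> //.
- by move=> x y t t01; have := cf (x i) (y i) t t01; rewrite !ffunE.
- apply: (@lower_semicontinuous_comp _ _ _ (fun x : {ffun I -> X} => x i)) => //.
  move=> x; apply/(@cvgrPdist_lt _ _ _ (nbhs x)) => e e0.
  apply/nbhs_ballP; exists e => // y; rewrite -ball_normE /= => xy.
  apply: le_lt_trans xy; have := normr_coord_le (x - y)%R i.
  by rewrite !ffunE.
Qed.

Lemma convex_lsc_proper_closed_convex {H : finHilbertType R} (f : H -> \bar R) :
  convex_lsc_proper f -> closed_convex f.
Proof. by move=> [cf lf [f0 _]]; split. Qed.

Lemma separable_sum_closed_convex {X : finHilbertType R} {m : nat} (g : 'I_m -> X -> \bar R) :
  (forall i, convex_lsc_proper (g i)) -> closed_convex (separable_sum g).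
Proof.
move=> cg; apply: closed_convex_sum => i.
exact/closed_convex_coord/convex_lsc_proper_closed_convex.
Qed.

Lemma separable_sum_dom {X : finHilbertType R} {m : nat} (g : 'I_m -> X -> \bar R) :
  (forall i, convex_lsc_proper (g i)) -> effective_dom (separable_sum g) !=set0.
Proof.
move=> cg; have /choice[p pP] : forall i, exists p, g i p < +oo.
  by move=> i; have [_ _ [_ [p pP]]] := cg i; exists p.
exists [ffun i => p i]; apply: lte_sum_pinfty => i _.
by rewrite ffunE.
Qed.

End ConvexLsc.

Section Prox.
Context {R : realType} {H : finHilbertType R}.
Local Open Scope ereal_scope.

Definition affine_minorant (f : H -> \bar R) (b : H) (C : R) :=
  forall x, (inner x b - C)%:E <= f x.

(** [C] is the value of the conjugate at [b], which is finite since [f] is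
    proper. *)
Lemma fenchel_dom_affine_minorant (f : H -> \bar R) b :
  effective_dom f !=set0 -> (forall x, -oo < f x) ->
  effective_dom (fenchel_conjugate f) b -> exists C, affine_minorant f b C.
Proof.
move=> [p pf] f0; rewrite /effective_dom /= /fenchel_conjugate.
set M := ereal_sup _ => Moo.
have leM x : (inner x b)%:E - f x <= M by apply: ereal_sup_ubound; exists x.
have Mfin : M \is a fin_num.
  rewrite fin_numE (lt_eqF Moo) andbT gt_eqF//.
  apply: lt_le_trans (leM p); move: pf (f0 p); rewrite /effective_dom /=.
  by case: (f p) => // r _ _; rewrite -EFinB ltNyr.
exists (fine M) => x; have := leM x; rewrite -{1}(fineK Mfin).
move: (f0 x); case: (f x) => [r| |]// _; rewrite ?leey// -EFinB !lee_fin.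
by move=> h; lra.
Qed.

Section ProxOf.
Variable f : H -> \bar R.
Hypothesis f_cc : closed_convex f.
Hypothesis f_dom : effective_dom f !=set0.

Let f0 : forall x, -oo < f x. Proof. exact: cc_ninfty. Qed.

Lemma subdifferential_fin_num u x : subdifferential f x u -> f x \is a fin_num.
Proof.
move=> xu; rewrite fin_numE (gt_eqF (f0 x)) /=; apply/negP => /eqP fx.
have [p pf] := f_dom; have := xu p; rewrite fx addey// leye_eq => /eqP fp.
by move: pf; rewrite /effective_dom /= fp ltxx.
Qed.

Lemma subdifferential_monotone x y u w : subdifferential f x u ->
  subdifferential f y w -> (0 <= inner (x - y)%R (u - w)%R)%R.
Proof.
move=> xu yw; have := xu y; have := yw x.
rewrite -(fineK (subdifferential_fin_num xu)) -(fineK (subdifferential_fin_num yw)).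
rewrite -!EFinD !lee_fin !innerE => h1 h2; lra.
Qed.

Definition prox_objective x z := f z + (2^-1 * `|x - z| ^+ 2)%:E.

(** The affine minorant makes the objective coercive, which bounds its sublevel
    sets. *)
Lemma prox_exists b C x : affine_minorant f b C -> argmin (prox_objective x) !=set0.
Proof.
move=> fbC; have [p pf] := f_dom.
have pfin : f p \is a fin_num by rewrite fin_numE (gt_eqF (f0 p)) lt_eqF.
pose M := fine (f p).
pose K := (M + 2^-1 * `|x - p| ^+ 2 + C - inner x b)%R.
have [|||c _ cmin] := @Weierstrass_closed _ _ _ _ setT (prox_objective x) p
    (`|x| + (2 * `|b| + 1 + 2 * `|K|))%R.
- by [].
- move=> y _; rewrite setTI; apply: lower_semicontinuous_sublevel.
    by move=> z; rewrite /prox_objective; move: (f0 z); case: (f z) => // r _; rewrite -EFinD ltNyr.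
  apply: lower_semicontinuousD => [//|z||]; [exact: ltNyr|exact: cc_lsc|].
  apply: lower_semicontinuous_EFin => z.
  apply: cvgMl_tmp; rewrite expr2; under eq_fun do rewrite expr2.
  have h : (`|x - z0| @[z0 --> z] --> `|x - z|)%R.
    by apply: cvg_norm; apply: cvgB; [exact: cvg_cst|exact: cvg_id].
  exact: (cvgM h h).
- move=> z _; rewrite /prox_objective -(fineK pfin) -/M -EFinD => zp.
  have {zp} h : (inner z b - C + 2^-1 * `|x - z| ^+ 2 <= M + 2^-1 * `|x - p| ^+ 2)%R.
    by rewrite -lee_fin EFinD; apply: le_trans zp; rewrite leeD2r.
  have cs := CauchySchwarz (x - z)%R b.
  have cs' := ler_norm (inner (x - z)%R b).
  rewrite innerBl in cs cs'.
  have -> : z = (x - (x - z))%R by rewrite subKr.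
  rewrite (le_trans (ler_normB _ _))// lerD2l.
  have b0 := normr_ge0 b; have r0 := normr_ge0 (x - z)%R.
  have k0 := normr_ge0 K; have kK := ler_norm K.
  have {h cs cs'} h : (2^-1 * `|x - z| ^+ 2 - `|b| * `|x - z| <= `|K|)%R.
    move: kK; rewrite {1}/K (mulrC `|b|%R) => kK.
    apply: le_trans kK; lra.
  set r := `|x - z|%R in r0 h *; set be := `|b|%R in b0 h *.
  (* A larger [r] would satisfy [r <= r * (r - 2 * be) <= 2 * |K|]. *)
  rewrite leNgt; apply/negP => rbig.
  have : (r <= r * (r - 2 * be))%R by rewrite ler_peMr//; lra.
  rewrite expr2 in h; lra.
by exists c => y; exact: cmin.
Qed.

(** First-order optimality: compare the minimizer [p] with the points
    [p + t (y - p)] and let [t] decrease to zero. *)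
Lemma prox_objective_subdifferential x p :
  argmin (prox_objective x) p -> subdifferential f p (x - p)%R.
Proof.
move=> pmin.
have pfin : f p \is a fin_num.
  have [q qf] := f_dom.
  rewrite fin_numE (gt_eqF (f0 p)) /=; apply/negP => /eqP fp.
  have := pmin q; rewrite /prox_objective fp addye// leye_eq.
  by move: qf (f0 q); rewrite /effective_dom /=; case: (f q).
move=> y; move: (f0 y); case E : (f y) => [fy| |]// _; last by rewrite leey.
rewrite -(fineK pfin) -EFinD lee_fin.
set fp := fine (f p).
set d := inner (y - p)%R (x - p)%R.
set n := inner (y - p)%R (y - p)%R.
have n0 : (0 <= n)%R by exact: inner_ge0.
have key (t : R) : (0 < t <= 1)%R -> (d + fp - fy <= 2^-1 * t * n)%R.
  move=> /andP[t0 t1].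
  have t01 : (0 <= t <= 1)%R by rewrite ltW.
  have := cc_convex f_cc y p t01; rewrite E => h1.
  have h2 := pmin (t *: y + (1 - t) *: p)%R.
  have h3 := le_trans h2 (leeD h1 (lexx _)).
  move: h3; rewrite /prox_objective -(fineK pfin) -/fp -!EFinM -!EFinD lee_fin.
  rewrite !normr2.
  have -> : (inner (x - (t *: y + (1 - t) *: p)) (x - (t *: y + (1 - t) *: p)) =
     inner (x - p) (x - p) - 2 * t * d + t ^+ 2 * n)%R.
    rewrite /d /n !innerE (innerC y x) (innerC p x) (innerC p y); ring.
  move=> h3; rewrite -(ler_pM2l t0); lra.
rewrite -subr_ge0 -oppr_le0 leNgt; apply/negP => pos.
pose s := (d + fp - fy)%R.
have s0 : (0 < s)%R by rewrite /s; lra.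
(* This [t] is at most 1 and satisfies [t * n < 2 * s]. *)
pose t := (s / (s + n))%R.
have sn : (0 < s + n)%R by lra.
have := key t; rewrite /t divr_gt0//= ler_pdivrMr// mul1r => /(_ _)/wrap[]; first lra.
rewrite -/s leNgt => /negP; apply.
rewrite (_ : 2^-1 * (s / (s + n)) * n = (2^-1 * s * n) / (s + n))%R; last by ring.
rewrite ltr_pdivrMr//; nra.
Qed.

Lemma proxP b C x : affine_minorant f b C ->
  subdifferential f (prox f x) (x - prox f x)%R.
Proof.
move=> fbC; apply: prox_objective_subdifferential.
exact: (xgetPex _ (prox_exists x fbC)).
Qed.

(** Together with [proxP] this is the resolvent identity
    [prox f = (Id + subdifferential f)^-1]. *)
Lemma prox_unique b C x p : affine_minorant f b C ->
  subdifferential f p (x - p)%R -> prox f x = p.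
Proof.
move=> fbC fp; have fq := proxP x fbC; set q := prox f x in fq *.
have := subdifferential_monotone fq fp.
rewrite (_ : inner _ _ = - inner (q - p) (q - p))%R; last first.
  rewrite !innerE (innerC p q); ring.
rewrite oppr_ge0 => h; apply/subr0_eq/inner_eq0/eqP.
by rewrite eq_le h inner_ge0.
Qed.

End ProxOf.
End Prox.

(** * The Douglas-Rachford operator of a subspace and a function *)

Section DouglasRachford.
Context {R : realType} {H : finHilbertType R} (D : set H) (G : H -> \bar R).
Hypothesis D_lin : forall (a : R) x y, D x -> D y -> D (a *: x + y).
(** Every subspace splits the space in this way; for the diagonal the projection
    is given by the average. *)
Hypothesis D_proj : forall x,
  D (projector D x) /\ orthogonal_compl D (x - projector D x).
Hypothesis G_cc : closed_convex G.
Hypothesis G_dom : effective_dom G !=set0.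
Variables (b : H) (C : R).
Hypothesis b_orth : orthogonal_compl D b.
Hypothesis G_minorant : affine_minorant G b C.

Local Notation P := (projector D).
Local Notation J := (prox G).
Local Notation T := (DR_operator D G).
Local Notation "'Dp'" := (orthogonal_compl D).
Local Notation dG := (subdifferential G).

Let DB x y : D x -> D y -> D (x - y).
Proof. by move=> Dx Dy; rewrite addrC -scaleN1r; exact: D_lin. Qed.

Let DZ (a : R) x : D x -> D (a *: x).
Proof.
move=> Dx; rewrite -[_ *: _]addr0 -(subrr x).
by apply: D_lin => //; exact: DB.
Qed.

Lemma orthogonal_compl_lin (a : R) k l : Dp k -> Dp l -> Dp (a *: k + l).
Proof. by move=> ok ol x Dx; rewrite !innerE ok// ol// mulr0 addr0. Qed.

Let DpB k l : Dp k -> Dp l -> Dp (k - l).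
Proof. by move=> ok ol; rewrite addrC -scaleN1r; exact: orthogonal_compl_lin. Qed.

Lemma projector_decomp z k : D z -> Dp k -> P (z + k) = z.
Proof.
move=> Dz ok; have [DP oP] := D_proj (z + k).
have Dd := DB Dz DP; apply/esym/subr0_eq/inner_eq0.
have := oP _ Dd; have := ok _ Dd; rewrite !innerE => h1 h2.
lra.
Qed.

Lemma projector_inner x : inner x x =
  inner (P x) (P x) + inner (x - P x) (x - P x).
Proof.
have [Dx ox] := D_proj x; have := ox _ Dx.
rewrite !innerE (innerC x (P x)) => h; lra.
Qed.

Lemma projectorB x y : P (x - y) = P x - P y.
Proof.
have [Dx ox] := D_proj x; have [Dy oy] := D_proj y.
rewrite -(projector_decomp (DB Dx Dy) (DpB ox oy)).
by congr P; vect.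
Qed.

Lemma projector_norm_le x : `|P x| <= `|x|.
Proof. by rewrite ler_norm_inner [leRHS]projector_inner lerDl inner_ge0. Qed.

Lemma subspace_closed : closed D.
Proof.
move=> x cx; have [Dx ox] := D_proj x.
suff -> : x = P x by [].
apply/subr0_eq/eqP; rewrite -normr_le0; apply/ler_addgt0Pl => e e0; rewrite addr0.
have [y [Dy]] := cx _ (nbhsx_ballx x e e0); rewrite -ball_normE /= => xy.
apply: le_trans (ltW xy); rewrite ler_norm_inner.
have := ox _ Dy; have := ox _ Dx; have := inner_ge0 (P x - y).
rewrite !innerE (innerC y x) (innerC (P x) x) (innerC y (P x)) => h1 h2 h3.
lra.
Qed.

Let J_sub x : dG (J x) (x - J x). Proof. exact: (proxP G_cc G_dom). Qed.

Let J_uniq x p : dG p (x - p) -> J x = p.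
Proof. exact: (prox_unique G_cc G_dom). Qed.

Lemma DR_displacement x : x - T x = P x - J (reflector D x).
Proof. by rewrite /DR_operator; vect. Qed.

(** For [x = z + k] the reflection is [z - k], so the displacement is [w] exactly
    when [prox G (z - k) = z - w], a condition on the subdifferential of [G]. *)
Lemma DR_displacementP z k w : D z -> Dp k ->
  (z + k) - T (z + k) = w <-> dG (z - w) (w - k).
Proof.
move=> Dz ok; rewrite DR_displacement /reflector projector_decomp//.
have -> : 2 *: z - (z + k) = z - k by vect.
split=> [zw|zw].
  have := J_sub (z - k); have -> : J (z - k) = z - w by rewrite -zw; vect.
  by congr (dG _ _); vect.
have -> : J (z - k) = z - w; last by vect.
by apply: J_uniq; move: zw; congr (dG _ _); vect.
Qed.

(** With [A] the projection of [x - y] and [jj] the difference of the proximal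
    points, the gap between the two sides is
    [2 * inner jj (2 *: A - (x - y) - jj)], nonnegative because the
    subdifferential is monotone. *)
Lemma DR_firmly_nonexpansive x y :
  inner (T x - T y) (T x - T y) +
  inner ((x - T x) - (y - T y)) ((x - T x) - (y - T y)) <= inner (x - y) (x - y).
Proof.
have [Dx ox] := D_proj x; have [Dy oy] := D_proj y.
have mono := subdifferential_monotone G_cc G_dom
  (J_sub (reflector D x)) (J_sub (reflector D y)).
rewrite /DR_operator.
set j := J (reflector D x) in mono *; set l := J (reflector D y) in mono *.
rewrite /reflector in mono.
have o := DpB ox oy (DB Dx Dy).
set a := P x in mono o *; set c := P y in mono o *.
pose d := x - y; pose A := a - c; pose jj := j - l.
have -> : x - a + j - (y - c + l) = d - A + jj by rewrite /d /A /jj; vect.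
have -> : x - (x - a + j) - (y - (y - c + l)) = A - jj by rewrite /A /jj; vect.
rewrite -/d.
have {}mono : 0 <= inner jj (2 *: A - d - jj).
  by move: mono; congr (0 <= inner _ _); rewrite /A /d /jj; vect.
have {}o : inner A (d - A) = 0.
  by rewrite -o; congr (inner _ _); rewrite /A /d; vect.
move: mono o; clearbody d A jj.
rewrite !innerE (innerC A d) (innerC jj d) (innerC jj A) => h1 h2.
lra.
Qed.

Lemma DR_nonexpansive x y : inner (T x - T y) (T x - T y) <= inner (x - y) (x - y).
Proof. by apply: le_trans (DR_firmly_nonexpansive x y); rewrite lerDl inner_ge0. Qed.

(** From here on [v] is a displacement of minimal norm that is attained, at
    [z0 + k0]. *)
Variable v : H.
Hypothesis v_min : forall x, inner v v <= inner (x - T x) (x - T x).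
Variables z0 k0 : H.
Hypotheses (Dz0 : D z0) (ok0 : Dp k0) (z0k0 : dG (z0 - v) (v - k0)).

(** Firm nonexpansiveness at [x] and [T x] gives
    [|w|^2 + |v - w|^2 <= |v|^2] for the next displacement [w], while
    [|v| <= |w|]. *)
Lemma displacement_preserved x : x - T x = v -> T x - T (T x) = v.
Proof.
move=> xv; have := DR_firmly_nonexpansive x (T x); have := v_min (T x).
rewrite xv; set w := T x - T (T x) => h1 h2.
apply/esym/subr0_eq/inner_eq0/eqP; rewrite eq_le inner_ge0 andbT; lra.
Qed.

Lemma displacement_orbit x n : x - T x = v ->
  (x - n%:R *: v) - T (x - n%:R *: v) = v.
Proof.
move=> xv; elim: n => [|n IH]; first by rewrite scale0r subr0.
have -> : x - n.+1%:R *: v = T (x - n%:R *: v).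
  set X := x - n%:R *: v in IH *.
  have -> : T X = X - v by rewrite -[in RHS]IH; vect.
  by rewrite /X -natr1; vect.
exact: displacement_preserved.
Qed.

Lemma displacement_base : (z0 + k0) - T (z0 + k0) = v.
Proof. exact/DR_displacementP. Qed.

(** Let [d] be the projection of [v]. The points [z0 + k0 - j v] all have
    displacement [v], which says that [v - k0 + j (v - d)] is a subgradient at
    [z0 - j d - v]. Comparing with [z0 - v] shows that [G (z0 - j d - v)] drops
    at least like [- j |d|^2], whereas the affine minorant, whose slope [b] is
    orthogonal to [D], keeps it bounded below. *)
Lemma displacement_orthogonal : Dp v.
Proof.
have [Dd oq] := D_proj v; set d := P v in Dd oq; pose q := v - d.
pose M := fine (G (z0 - v)).
have Mfin := subdifferential_fin_num G_cc G_dom z0k0.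
have key (j : nat) : j%:R * inner d d <= M + C + inner v b.
  have := displacement_orbit j displacement_base.
  have -> : z0 + k0 - j%:R *: v = (z0 - j%:R *: d) + (k0 - j%:R *: q).
    by rewrite /q; vect.
  move=> /(DR_displacementP _ (DB Dz0 (DZ j%:R Dd)))/wrap[].
    by rewrite addrC -scaleNr; exact: orthogonal_compl_lin.
  move=> /(_ (z0 - v)); rewrite -(fineK Mfin) -/M => h.
  have := le_trans (leeD (lexx _) (G_minorant (z0 - j%:R *: d - v))) h.
  rewrite -EFinD lee_fin /q.
  have := oq _ Dd; have := ok0 Dd; have := b_orth Dz0; have := b_orth Dd.
  rewrite !innerE (innerC v d) => h1 h2 h3 h4.
  have -> : inner d v = inner d d by lra.
  rewrite h1 h2 h3; lra.
suff d0 : inner d d = 0 by move/inner_eq0 : d0 oq => ->; rewrite subr0.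
apply/eqP; rewrite eq_le inner_ge0 andbT leNgt; apply/negP => d0.
have := archi_boundP (normr_ge0 ((M + C + inner v b) / inner d d)).
rewrite -(ltr_pM2r d0) => /lt_le_trans/(_ (key _)); rewrite ltNge => /negP; apply.
by rewrite -ler_pdivrMr// ler_norm.
Qed.

Let ov := displacement_orthogonal.

Definition DR_fix : set H := [set u | u = T (u + v)].

Lemma DR_fixE u : DR_fix u <-> (u + v) - T (u + v) = v.
Proof.
rewrite /DR_fix /=; split=> [uT|h]; first by rewrite -uT; vect.
have -> : T (u + v) = (u + v) - v by rewrite -[X in _ = _ - X]h; vect.
by vect.
Qed.

Lemma DR_fix_decomp u : DR_fix u ->
  [/\ D (P u), Dp (u + v - P u) & dG (P u - v) (v - (u + v - P u))].
Proof.
move=> /DR_fixE uT; have [Du ou] := D_proj u.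
have ok : Dp (u + v - P u).
  have -> : u + v - P u = 1 *: (u - P u) + v by vect.
  exact: orthogonal_compl_lin.
split=> //; apply/DR_displacementP => //.
by have -> : P u + (u + v - P u) = u + v by vect.
Qed.

Lemma DR_fix_intro z k : D z -> Dp k -> dG (z - v) (v - k) -> DR_fix (z + k - v).
Proof.
move=> Dz ok /(DR_displacementP _ Dz ok) h; apply/DR_fixE.
by have -> : z + k - v + v = z + k by vect.
Qed.

Lemma subdifferential_minimizes z k z' : D z -> Dp k -> dG (z - v) (v - k) ->
  D z' -> (G (z - v)%R <= G (z' - v)%R)%E.
Proof.
move=> Dz ok zk Dz'; have := zk (z' - v).
have -> : inner (z' - v - (z - v)) (v - k) = 0; last by rewrite add0e.
rewrite -(DpB ov ok (DB Dz' Dz)); congr (inner _ _); vect.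
Qed.

(** [v - k] is orthogonal to [D], so the affine function which supports [G] at
    [z - v] takes the same value at [z' - v], where it touches [G]
    as well. Hence the pairs [(z, k)] that
    describe [DR_fix] form a product set. *)
Lemma subdifferential_exchange z k z' : D z -> Dp k -> dG (z - v) (v - k) ->
  D z' -> (G (z' - v)%R <= G (z - v)%R)%E -> dG (z' - v) (v - k).
Proof.
move=> Dz ok zk Dz' z'z y; apply: le_trans (zk y).
have -> : inner (y - (z' - v)) (v - k) = inner (y - (z - v)) (v - k).
  have := DpB ov ok (DB Dz' Dz); rewrite !innerBl => h; lra.
exact: leeD2l.
Qed.

(** The fixed point set of a nonexpansive map of a Hilbert space is convex. *)
Lemma DR_fix_midpoint : midpoint_closed DR_fix.
Proof.
move=> u u' uF u'F; set w := _ *: _.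
rewrite /DR_fix /=; apply/esym/subr0_eq/inner_eq0/eqP; rewrite eq_le inner_ge0 andbT.
have := DR_nonexpansive (w + v) (u + v); have := DR_nonexpansive (w + v) (u' + v).
rewrite -uF -u'F; move: (T (w + v)) => S.
have -> : w + v - (u' + v) = 2^-1 *: (u - u') by rewrite /w; vect.
have -> : w + v - (u + v) = 2^-1 *: (u' - u) by rewrite /w; vect.
rewrite /w !innerE (innerC u S) (innerC u' S) (innerC u' u) => h1 h2.
lra.
Qed.

Lemma DR_fix_closed : closed DR_fix.
Proof.
move=> u cu; rewrite /DR_fix /=.
apply/subr0_eq/eqP; rewrite -normr_le0; apply/ler_addgt0Pl => e e0; rewrite addr0.
have e2 : 0 < e / 2 by rewrite divr_gt0.
have [u' [u'F]] := cu _ (nbhsx_ballx u _ e2); rewrite -ball_normE /= => uu'.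
rewrite (le_trans (ler_distD u' _ _))// (splitr e) lerD ?(ltW uu')//.
rewrite [X in X - _]u'F; apply: le_trans (ltW uu'); rewrite distrC.
rewrite ler_norm_inner; apply: le_trans (DR_nonexpansive _ _) _.
by have -> : u + v - (u' + v) = u - u' by vect.
Qed.

(** [v] is normal to the domain of [G] at [z0 - v]: every [v - k0 + j v] is a
    subgradient there, because [z0 + k0 - j v] has displacement [v] too. *)
Lemma domain_halfspace y : (G y < +oo)%E -> inner (y - (z0 - v)) v <= 0.
Proof.
move=> yoo; rewrite leNgt; apply/negP => pos.
have Mfin := subdifferential_fin_num G_cc G_dom z0k0.
have yfin : G y \is a fin_num by rewrite fin_numE gt_eqF ?lt_eqF// (cc_ninfty G_cc).
set c := inner _ v in pos.
pose B := fine (G y) - fine (G (z0 - v)) - inner (y - (z0 - v)) (v - k0).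
have key (j : nat) : j%:R * c <= B.
  have := displacement_orbit j displacement_base.
  have -> : z0 + k0 - j%:R *: v = z0 + (k0 - j%:R *: v) by vect.
  move=> /(DR_displacementP _ Dz0)/wrap[].
    by rewrite addrC -scaleNr; exact: orthogonal_compl_lin.
  move=> /(_ y); rewrite -(fineK Mfin) -(fineK yfin) -EFinD lee_fin.
  by rewrite /B /c !innerE => h; lra.
have := archi_boundP (normr_ge0 (B / c)).
rewrite -(ltr_pM2r pos) => /lt_le_trans/(_ (key _)); rewrite ltNge => /negP; apply.
by rewrite -ler_pdivrMr// ler_norm.
Qed.

(** * Limits along an orbit *)

Section Orbit.
Variable x0 : H.

(** [s] is the orbit with its drift [- n v] removed; [e] measures how far the
    displacement is from [v]; [a] is the shadow of the orbit and [p] its proximal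
    point. *)
Let X n := iter n T x0.
Let s n := n%:R *: v + X n.
Let e n := X n - T (X n) - v.
Let a n := P (X n).
Let p n := J (reflector D (X n)).

Lemma DR_step n : X n.+1 - X n + a n = p n.
Proof. by rewrite /X iterS {1}/DR_operator -/(X n) -/(p n) -/(a n); vect. Qed.

Let pE n : p n = a n - v - e n.
Proof. by rewrite -DR_step /e /X iterS; vect. Qed.

(** For [u] in [DR_fix] the points [u - n v] form an orbit, with which the orbit
    of [x0] is compared by firm nonexpansiveness. *)
Lemma DR_Fejer_strict u n : DR_fix u ->
  inner (s n.+1 - u) (s n.+1 - u) + inner (e n) (e n) <= inner (s n - u) (s n - u).
Proof.
move=> /DR_fixE uv; have := displacement_orbit n.+1 uv.
have -> : u + v - n.+1%:R *: v = u - n%:R *: v by rewrite -natr1; vect.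
set Y := u - n%:R *: v => YT.
have TY : T Y = Y - v by rewrite -[X in _ = _ - X]YT; vect.
have := DR_firmly_nonexpansive (X n) Y.
have -> : T (X n) - T Y = s n.+1 - u.
  by rewrite TY /Y /s /X iterS -natr1; vect.
have -> : X n - T (X n) - (Y - T Y) = e n by rewrite TY /e; vect.
by have -> : X n - Y = s n - u by rewrite /Y /s; vect.
Qed.

Lemma DR_Fejer : Fejer_monotone DR_fix s.
Proof.
move=> u uF n; rewrite ler_norm_inner; apply: le_trans (DR_Fejer_strict n uF).
by rewrite lerDl inner_ge0.
Qed.

Let u0 := z0 + k0 - v.
Let u0F : DR_fix u0. Proof. exact: DR_fix_intro. Qed.

Lemma displacement_cvg : e @ \oo --> (0 : H).
Proof.
have h := @nonincreasing_diff_cvg0 R (fun n => inner (s n - u0) (s n - u0)).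
have {}h := h (fun n => inner_ge0 _).
have /h/cvgrPdist_lt {}h : forall n,
    inner (s n.+1 - u0) (s n.+1 - u0) <= inner (s n - u0) (s n - u0).
  by move=> n; rewrite -ler_norm_inner; exact: DR_Fejer.
apply/cvgrPdist_lt => eps eps0.
have [N _ hN] := h _ (exprn_gt0 2 eps0).
exists N => // n Nn; rewrite sub0r normrN.
rewrite -(@ltr_pXn2r _ 2)// ?nnegrE ?normr_ge0// ?ltW// normr2.
have := hN n Nn; rewrite sub0r normrN ltr_norml => /andP[_ +].
have := DR_Fejer_strict n u0F; move=> h1 h2; lra.
Qed.

Let sB n : `|s n| <= `|s 0%N - u0| + `|u0|.
Proof. exact: (Fejer_bounded DR_Fejer u0F). Qed.

Lemma shadow_projector n : P (s n) = a n.
Proof.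
have [Da oa] := D_proj (X n).
have -> : s n = a n + (n%:R *: v + (X n - a n)) by rewrite /s; vect.
by apply: projector_decomp => //; exact: orthogonal_compl_lin.
Qed.

Let q_orth n : Dp (s n - a n).
Proof. by rewrite -shadow_projector; have [] := D_proj (s n). Qed.

Let Da n : D (a n). Proof. by have [] := D_proj (X n). Qed.

Let mu := fine (G (z0 - v)).
Let muE : G (z0 - v) = mu%:E.
Proof. by rewrite fineK//; exact: (subdifferential_fin_num G_cc G_dom z0k0). Qed.

Let p_sub n : dG (p n) (reflector D (X n) - p n).
Proof. exact: J_sub. Qed.

Let pfin n : G (p n) \is a fin_num.
Proof. exact: (subdifferential_fin_num G_cc G_dom (p_sub n)). Qed.

(** The subgradient of [G] at [p n] produced by the proximity operator is
    [(n + 1) v + e n - (s n - a n)]. Evaluated at [z0 - v], the growing part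
    [(n + 1) v] has the favourable sign by [domain_halfspace], and [s n - a n]
    pairs to zero with [z0 - a n], so only terms controlled by [e n] remain. *)
Let upper n : fine (G (p n)) <= mu - inner (z0 - s n + e n) (e n).
Proof.
have := p_sub n (z0 - v); rewrite -(fineK (pfin n)) muE -EFinD lee_fin.
have -> : reflector D (X n) - p n = n.+1%:R *: v + (e n - (s n - a n)).
  by rewrite pE /reflector -/(a n) /s -natr1; vect.
have zp : 0 <= n.+1%:R * inner (z0 - v - p n) v.
  rewrite mulr_ge0//.
  have := @domain_halfspace (p n); rewrite -(fineK (pfin n)) ltry => /(_ isT).
  rewrite !innerE; lra.
have o1 : inner (z0 - a n) (s n - a n) = 0 by exact: q_orth (DB Dz0 (Da n)).
have -> : inner (z0 - v - p n) (n.+1%:R *: v + (e n - (s n - a n))) =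
  n.+1%:R * inner (z0 - v - p n) v + inner (z0 - s n + e n) (e n)
   - inner (z0 - a n) (s n - a n).
  rewrite pE.
  move: (e n) (s n) (a n) => e' s' a'.
  rewrite !innerE (innerC e' s') (innerC e' a'); ring.
rewrite o1; lra.
Qed.

(** The fixed subgradient [v - k0] at [z0 - v] is orthogonal to [D]. *)
Let lower n : mu - inner (e n) (v - k0) <= fine (G (p n)).
Proof.
have := z0k0 (p n); rewrite -(fineK (pfin n)) muE -EFinD lee_fin.
have := DpB ov ok0 (DB (Da n) Dz0).
rewrite pE; move: (e n) (a n) => e' a'.
rewrite !innerE; lra.
Qed.

Lemma objective_cvg : G (p n) @[n --> \oo] --> G (z0 - v).
Proof.
rewrite muE; apply/fine_cvgP; split; first by apply: nearW => n.
apply: (@squeeze_cvgr _ _ _ _ (fun n => mu - inner (v - k0) (e n))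
    (fun n => mu - inner (z0 - s n + e n) (e n))).
- by apply: nearW => n /=; rewrite upper (innerC _ (e n)) lower.
- rewrite -[X in _ --> X](subr0 mu); apply: cvgB; first exact: cvg_cst.
  by apply: (@inner_cvg0 _ _ (fun=> v - k0) _ `|v - k0|) => [//|]; exact: displacement_cvg.
- rewrite -[X in _ --> X](subr0 mu); apply: cvgB; first exact: cvg_cst.
  rewrite (_ : (fun _ => _) = (fun n => inner (z0 - s n) (e n) + inner (e n) (e n))); last first.
    by apply/funext => n; rewrite innerDl.
  rewrite -[X in _ --> X](addr0 0); apply: cvgD.
    apply: (@inner_cvg0 _ _ (fun n => z0 - s n) _ (`|z0| + (`|s 0%N - u0| + `|u0|))).
      by move=> n; rewrite (le_trans (ler_normB _ _))// lerD2l.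
    exact: displacement_cvg.
  have := cvgM (cvg_norm displacement_cvg) (cvg_norm displacement_cvg).
  rewrite normr0 mulr0 => h.
  rewrite (_ : (fun _ => _) = (fun n => `|e n|) \* (fun n => `|e n|)); first exact: h.
  by apply/funext => n /=; rewrite -normr2 expr2.
Qed.

Let aB n : `|a n| <= `|s 0%N - u0| + `|u0|.
Proof.
by rewrite -shadow_projector; apply: le_trans (projector_norm_le _) (sB n).
Qed.

(** [p] differs from [a - v] by the vanishing [e], and [G (p n)] tends to
    [G (z0 - v)], so that lower semicontinuity applies at [c - v]. *)
Lemma shadow_cluster_minimizer c : cluster_pt a c ->
  D c /\ (G (c - v)%R <= G (z0 - v)%R)%E.
Proof.
move=> ac; split.
  apply: cluster_pt_closed ac; first exact: subspace_closed.
  by exists 0%N => // n _; exact: Da.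
have pc : cluster_pt p (c - v).
  move=> eps eps0 N; have eps2 : 0 < eps / 2 by rewrite divr_gt0.
  have /cvgrPdist_lt/(_ _ eps2)[M _ hM] := displacement_cvg.
  have [n Nn acn] := ac _ eps2 (maxn N M).
  exists n; first exact: leq_trans (leq_maxl _ _) Nn.
  have -> : p n - (c - v) = (a n - c) + (0 - e n) by rewrite pE; vect.
  rewrite (le_lt_trans (ler_normD _ _))// (splitr eps) ltrD//.
  by apply: hM; exact: leq_trans (leq_maxr _ _) Nn.
rewrite muE; apply/lee_addgt0Pr => eps eps0.
have [N _ hN] : \forall n \near \oo, (G (p n) <= mu%:E + eps%:E)%E.
  have := objective_cvg; rewrite muE => /fine_cvgP[_ /cvgrPdist_lt/(_ _ eps0)].
  apply: filterS => n /=; rewrite ltr_norml => /andP[+ _].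
  by rewrite -(fineK (pfin n)) -EFinD lee_fin => h; lra.
apply: (@cluster_pt_closed _ _ p _ [set y | G y <= mu%:E + eps%:E]%E) pc.
  by apply: lower_semicontinuous_sublevel; [exact: cc_ninfty|exact: cc_lsc].
by exists N.
Qed.

Let DR_fix_minimizer z k c : D z -> Dp k -> dG (z - v) (v - k) -> D c ->
  (G (c - v)%R <= G (z0 - v)%R)%E -> DR_fix (c + k - v).
Proof.
move=> Dz ok zk Dc cz; apply: DR_fix_intro => //.
apply: subdifferential_exchange ok zk Dc _ => //.
exact: le_trans cz (subdifferential_minimizes Dz0 ok0 z0k0 Dz).
Qed.

(** Two cluster points [c], [c'] give two points [c + k0 - v], [c' + k0 - v] of
    [DR_fix]. The difference of the squared distances of [s n] to them converges
    and is, up to a constant, [2 * inner (a n) (c - c')]. *)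
Lemma shadow_cvg : exists2 c, a @ \oo --> c & D c /\ (G (c - v)%R <= G (z0 - v)%R)%E.
Proof.
have [c c' cc cc'|c cc ac] := opial_cvg aB; last first.
  by exists c => //; exact: shadow_cluster_minimizer.
have [Dc cmin] := shadow_cluster_minimizer cc.
have [Dc' cmin'] := shadow_cluster_minimizer cc'.
have F1 := DR_fix_minimizer Dz0 ok0 z0k0 Dc cmin.
have F2 := DR_fix_minimizer Dz0 ok0 z0k0 Dc' cmin'.
have /cvg_ex[l1 h1] := Fejer_dist_cvg DR_Fejer F1.
have /cvg_ex[l2 h2] := Fejer_dist_cvg DR_Fejer F2.
pose K := inner (c + k0 - v) (c + k0 - v) - inner (c' + k0 - v) (c' + k0 - v).
apply/cvg_ex; exists (2^-1 * (l2 - l1 + K)).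
rewrite (_ : (fun _ => _) = fun n => 2^-1 *
  (inner (s n - (c' + k0 - v)) (s n - (c' + k0 - v)) -
   inner (s n - (c + k0 - v)) (s n - (c + k0 - v)) + K)).
  apply: cvgMl_tmp; apply: cvgD; last exact: cvg_cst.
  by apply: cvgB; [exact: h2|exact: h1].
apply/funext => n; rewrite /K.
have := q_orth n (DB Dc Dc').
set f := c + k0 - v; have -> : c' + k0 - v = f - (c - c') by rewrite /f; vect.
set d := c - c'; clearbody f d; move: (s n) (a n) => s' a'.
rewrite !innerE (innerC f s') (innerC d s') (innerC d f) (innerC d a') => o.
lra.
Qed.

(** If [m] is the projection of the nearest point [w n], then [w n - m + c] also
    belongs to [DR_fix] by [subdifferential_exchange], so minimality of [w n]
    gives [|a n - m| <= |a n - c|]. Hence the projections of [w n] tend to [c]. *)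
Lemma DR_shadow_limit : exists2 y, projector DR_fix (s n) @[n --> \oo] --> y &
  [/\ a @ \oo --> P y, p @ \oo --> - v + P y,
   forall z, D z -> (G (P y - v)%R <= G (z - v)%R)%E &
   G (p n) @[n --> \oo] --> G (P y - v)].
Proof.
have Fn0 : DR_fix !=set0 by exists u0.
have [y yF wy] := Fejer_projection_cvg DR_fix_closed Fn0 DR_fix_midpoint DR_Fejer.
exists y => //; have [c ac [Dc cmin]] := shadow_cvg.
pose w n := projector DR_fix (s n).
have Pwc n : `|a n - P (w n)| <= `|a n - c|.
  have [wF wmin] := projectorP (s n) DR_fix_closed Fn0.
  rewrite -/(w n) in wF wmin.
  have [Dw ok wk] := DR_fix_decomp wF.
  have := wmin _ (DR_fix_minimizer Dw ok wk Dc cmin); rewrite !ler_norm_inner.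
  set m := P (w n) in Dw ok wk *.
  have -> : s n - w n = (a n - m) + ((s n - a n) - (w n + v - m) + v) by vect.
  have -> : s n - (c + (w n + v - m) - v) =
     (a n - c) + ((s n - a n) - (w n + v - m) + v) by vect.
  have : Dp ((s n - a n) - (w n + v - m) + v).
    rewrite -[_ - (w n + v - m)]scale1r; apply: orthogonal_compl_lin => //.
    exact: DpB.
  move: ((s n - a n) - (w n + v - m) + v) => k kD.
  have := kD _ (DB (Da n) Dw); have := kD _ (DB (Da n) Dc).
  move: (a n - m) (a n - c) => f1 f2.
  rewrite !innerE (innerC k f1) (innerC k f2) => -> ->; lra.
have Pyc : P y = c.
  apply/subr0_eq/eqP; rewrite -normr_le0; apply/ler_addgt0Pl => eps eps0; rewrite addr0.
  have eps3 : 0 < eps / 3 by rewrite divr_gt0.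
  have /cvgrPdist_lt/(_ _ eps3)[N1 _ hN1] := ac.
  have /cvgrPdist_lt/(_ _ eps3)[N2 _ hN2] := wy.
  have := hN1 (maxn N1 N2) (leq_maxl _ _); have := hN2 (maxn N1 N2) (leq_maxr _ _).
  move: (maxn N1 N2) => n; rewrite /= -/(w n) (distrC c) => h2 h1.
  have h3 := projector_norm_le (y - w n); rewrite projectorB in h3.
  have h4 := Pwc n; rewrite distrC in h4.
  have := ler_distD (P (w n)) (P y) c.
  have := ler_distD (a n) (P (w n)) c; lra.
rewrite Pyc; have GE : G (c - v) = G (z0 - v).
  by apply/eqP; rewrite eq_le cmin (subdifferential_minimizes Dz0 ok0 z0k0 Dc).
split=> //.
- rewrite (_ : p = fun n => a n - v - e n); last by apply/funext => n; exact: pE.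
  rewrite addrC -[X in _ --> X]subr0; apply: cvgB displacement_cvg.
  by apply: cvgB => //; exact: cvg_cst.
- move=> z Dz; rewrite GE; exact: (subdifferential_minimizes Dz0 ok0 z0k0 Dz).
- by rewrite GE; exact: objective_cvg.
Qed.

End Orbit.

End DouglasRachford.

(** * The diagonal of a Hilbert sum *)

Section Diagonal.
Context {R : realType} {X : finHilbertType R} {m : nat}.
Local Notation H := {ffun 'I_m -> X}.
Implicit Types x : H.

Lemma diag_subspace_lin (a : R) x y :
  diag_subspace x -> diag_subspace y -> diag_subspace (a *: x + y).
Proof.
move=> [z _ <-] [w _ <-]; exists (a *: z + w) => //.
by apply/ffunP => i; rewrite !ffunE.
Qed.

Lemma diag_average_orthogonal x : (0 < m)%N ->
  orthogonal_compl diag_subspace (x - [ffun=> average x]).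
Proof.
move=> m0 _ [z _ <-].
rewrite [LHS](_ : _ = \sum_i inner z (x i - average x)); last first.
  by apply: eq_bigr => i _; rewrite !ffunE.
have innerz : {morph (fun y => inner z y) : u w / u + w}.
  by move=> u w; exact: innerDr.
rewrite -(big_morph _ innerz (inner0r z)) big_split/= sumr_const card_ord.
rewrite -scaler_nat /average scalerN scalerA divff ?pnatr_eq0 -?lt0n//.
by rewrite scale1r subrr inner0r.
Qed.

Lemma projector_diag x : (0 < m)%N ->
  projector diag_subspace x = [ffun=> average x].
Proof.
move=> m0; have o := diag_average_orthogonal x m0.
set p := finfun _ in o *.
have Dp : diag_subspace p by exists (average x).
have [Dq qmin] : nearest diag_subspace x (projector diag_subspace x).
  apply: xgetPex; exists p; split=> // q Dq; rewrite ler_norm_inner.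
  have := o _ (diag_subspace_lin (-1) Dq Dp); have := inner_ge0 (p - q).
  rewrite !innerE (innerC q x) (innerC p x) (innerC p q) => h1 h2; lra.
have := qmin _ Dp; rewrite ler_norm_inner.
move: (projector _ _) Dq {qmin} => q Dq.
have := o _ (diag_subspace_lin (-1) Dq Dp) => h1 h2.
apply/subr0_eq/inner_eq0/eqP; rewrite eq_le inner_ge0 andbT.
move: h1 h2; rewrite !innerE (innerC q x) (innerC p x) (innerC p q) => h1 h2; lra.
Qed.

Lemma projector_diag_decomp x : (0 < m)%N ->
  diag_subspace (projector diag_subspace x) /\
  orthogonal_compl diag_subspace (x - projector diag_subspace x).
Proof.
move=> m0; rewrite projector_diag//; split; first by exists (average x).
exact: diag_average_orthogonal.
Qed.

Lemma average_diag (c : X) : (0 < m)%N -> average ([ffun=> c] : H) = c.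
Proof.
move=> m0; rewrite /average (eq_bigr (fun=> c)) => [|i _]; last by rewrite ffunE.
by rewrite sumr_const card_ord -[c *+ m]scaler_nat scalerA mulVf ?scale1r// pnatr_eq0 -lt0n.
Qed.

End Diagonal.

(** * Minimal displacement, minimal values and the conclusion *)

Lemma min_displacement_le {R : realType} {H : finHilbertType R} (T : H -> H) x :
  inner (min_displacement T) (min_displacement T) <= inner (x - T x) (x - T x).
Proof.
have TC : closure (range (fun x => x - T x)) (x - T x).
  by apply: subset_closure; exists x.
have [_ /(_ _ TC)] := projectorP 0 (@closed_closure _ _) (ex_intro _ _ TC).
by rewrite !sub0r !normrN ler_norm_inner.
Qed.

Lemma argmin_minval {R : realType} {H : finHilbertType R} (f : H -> \bar R) x :
  argmin f x -> minval f = f x.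
Proof.
move=> xmin; apply/eqP; rewrite eq_le; apply/andP; split.
  by apply: ereal_inf_lbound; exists x.
by apply: le_ereal_inf_tmp => _ [y _ <-]; exact: xmin.
Qed.

Lemma argmin_indicatorD {R : realType} {H : finHilbertType R} (D : set H) (f : H -> \bar R) x :
  (forall y, -oo < f y)%E -> D x -> (forall y, D y -> f x <= f y)%E ->
  argmin (fun y => indicator_fun D y + f y)%E x.
Proof.
move=> f0 Dx xmin y; rewrite /indicator_fun mem_set// add0e.
case: ifPn => [/set_mem Dy|_]; first by rewrite add0e; exact: xmin.
by rewrite addye ?leey// gt_eqF.
Qed.

Theorem theorem6p6 (R : realType) (X : finHilbertType R) (m : nat)
    (g : 'I_m -> X -> \bar R) (x : {ffun 'I_m -> X}) :
  (2 <= m)%N ->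
  (forall i, convex_lsc_proper (g i)) ->
  let D : set {ffun 'I_m -> X} := diag_subspace in
  let G : {ffun 'I_m -> X} -> \bar R := separable_sum g in
  let T : {ffun 'I_m -> X} -> {ffun 'I_m -> X} := DR_operator D G in
  let v : {ffun 'I_m -> X} := min_displacement T in
  let Z : set {ffun 'I_m -> X} :=
    [set z | minkowski_sum (normal_cone D z) (subdifferential G (z - v)) v] in
  minkowski_sum (orthogonal_compl D) (effective_dom (fenchel_conjugate G)) 0 ->
  Z !=set0 ->
  let F : set {ffun 'I_m -> X} := [set u | u = T (u + v)] in
  let w (n : nat) : {ffun 'I_m -> X} :=
    projector F (n%:R *: v + iter n T x) in
  let y : {ffun 'I_m -> X} := lim (w @ \oo) in
  let h (z : {ffun 'I_m -> X}) : \bar R :=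
    (indicator_fun D z + G (z - v)%R)%E in
  [/\ cvg (w @ \oo),
      (projector D (iter n T x) @[n --> \oo] --> projector D y) /\
        argmin h (projector D y),
      (forall n, iter n.+1 T x - iter n T x + projector D (iter n T x) =
                 prox G (reflector D (iter n T x))) /\
        (prox G (reflector D (iter n T x)) @[n --> \oo]
           --> - v + projector D y),
      G (prox G (reflector D (iter n T x))) @[n --> \oo] --> minval h &
      argmin (fun z : X => (\sum_(i < m) g i (z - v i)%R)%E)
        (average (projector D y))].
Proof.
move=> m2 gP D G T v Z zero_in Z0 F w y h.
have m0 : (0 < m)%N by exact: ltn_trans m2.
have Gcc : closed_convex G by exact: separable_sum_closed_convex.
have Gdom : effective_dom G !=set0 by exact: separable_sum_dom.
have [a oa [b bdom ab0]] := zero_in.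
have ob : orthogonal_compl D b.
  have -> : b = - a by apply/eqP; rewrite -addr_eq0 addrC ab0.
  by move=> u Du; rewrite innerNr oa ?oppr0.
have [C Gb] := fenchel_dom_affine_minorant Gdom (cc_ninfty Gcc) bdom.
have [z0 [k0 k0N [s sG k0s]]] := Z0.
have [Dz0 ok0] : D z0 /\ orthogonal_compl D k0.
  by move: k0N; rewrite normal_cone_diag.
have z0k0 : subdifferential G (z0 - v) (v - k0).
  by have -> : v - k0 = s by rewrite -[X in X - _]k0s addrC addKr.
have Dproj (u : {ffun 'I_m -> X}) := projector_diag_decomp u m0.
have [y' wy' [Py py ymin Gp]] := DR_shadow_limit (@diag_subspace_lin _ _ _)
  Dproj Gcc Gdom ob Gb (@min_displacement_le _ _ T) Dz0 ok0 z0k0 x.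
have yE : y = y' by apply: cvg_lim wy'; exact: norm_hausdorff.
rewrite yE.
have hmin : argmin h (projector D y').
  apply: argmin_indicatorD => [z||]; first exact: (cc_ninfty Gcc).
    by case: (Dproj y').
  exact: ymin.
split.
- by apply/cvg_ex; exists y'.
- by split.
- by split=> // n; exact: DR_step.
- rewrite (argmin_minval hmin) /h /indicator_fun mem_set ?add0e//.
  by case: (Dproj y').
- rewrite projector_diag// average_diag// => c.
  have := ymin [ffun=> c] (ex_intro2 _ _ c Logic.I erefl).
  rewrite projector_diag// /G /separable_sum.
  by under eq_bigr do rewrite !ffunE; under [X in (_ <= X)%E -> _]eq_bigr do rewrite !ffunE.
Qed.
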